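(* Let $L=(L,\wedge,\vee,1,0)$ be a complete lattice and $X\subseteq L\setminus\{1\}$ a subset such that $L$ is an $X$-top lattice, and equip $X$ with its Zariski-like topology. The following are equivalent: (1) $X$ is $T_{\frac14}$; (2) $K.\dim(X)\le 1$; (3) $X$ is $T_F$.
   Context: For a complete lattice $L=(L,\wedge,\vee,1,0)$, $X\subseteq L\setminus\{1\}$ and $a\in L$, put $V(a)=\{x\in X: a\le x\}$ and $D(a)=X\setminus V(a)$. $L$ is an $X$-top lattice iff the family $\{V(a):a\in L\}$ is closed under finite unions (it always contains $X=V(0)$, $\emptyset=V(1)$ and is closed under arbitrary intersections); then the sets $D(a)$, $a\in L$, are the open sets of a topology on $X$, called the Zariski-like topology. $X$ is a poset with the order of $L$. The height of $x\in X$ is $ht(x)=\sup\{n\ge 0: \text{there are } x_0<\dots<x_n=x \text{ in } X\}$, and $K.\dim(X)=\sup\{ht(x):x\in X\}$ (suprema in $\{0,1,2,\dots,\infty\}$). A topological space $X$ is $T_{\frac14}$ iff every $x\in X$ is closed ($\{x\}$ is closed) or kerneled ($\{x\}$ equals the intersection of all open sets containing $x$). For subsets $A,B$ of a space $X$ write $A\vdash B$ iff there is an open $U\subseteq X$ with $A\subseteq U$ and $B\cap U=\emptyset$. $X$ is $T_F$ iff for every $x\in X$ and every finite $F\subseteq X\setminus\{x\}$, either $\{x\}\vdash F$ or $F\vdash\{x\}$. *)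

(* Defs.v *)
From HB Require Import structures.
From mathcomp Require Import all_boot all_order all_algebra.
From mathcomp Require Import all_classical constructive_ereal topology.

Set Implicit Arguments.
Unset Strict Implicit.
Unset Printing Implicit Defensive.

Import Order.TTheory.
Local Open Scope classical_set_scope.

HB.mixin Record TBLattice_isComplete (d : Order.disp_t) T
    & Order.TBLattice d T := {
  supremums_neq0 : forall A : set T, supremums A !=set0;
  infimums_neq0 : forall A : set T, infimums A !=set0
}.

#[short(type="completeLatticeType")]
HB.structure Definition CompleteLattice (d : Order.disp_t) :=
  { T of TBLattice_isComplete d T & Order.TBLattice d T }.

Definition variety (d : Order.disp_t) (L : completeLatticeType d) (X : set L)
    (a : L) : set X :=
  [set x : X | (a <= val x)%O].
Arguments variety {d L} X a.

(* Finite families of elements of L may be empty, which is harmless when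
   X does not contain the top: the empty set is then the variety of the top. *)
Definition xtop (d : Order.disp_t) (L : completeLatticeType d) (X : set L) :
    Prop :=
  forall A : set L, finite_set A ->
    exists c : L, \bigcup_(a in A) variety X a = variety X c.

(* The type of the points of X. The proof that L is an X-top lattice is a
   parameter so that the Zariski-like topology can be a canonical instance. *)
Definition zariski (d : Order.disp_t) (L : completeLatticeType d) (X : set L)
    (hL : xtop X) : Type := X.

Section ZariskiTopology.
Variables (d : Order.disp_t) (L : completeLatticeType d) (X : set L).
Variable hL : xtop X.
Local Notation Z := (zariski hL).

HB.instance Definition _ := SubChoice.copy Z X.
HB.instance Definition _ := [SubChoice_isSubPOrder of Z by <: with d].

Definition zariski_open : set_system Z :=
  [set U | exists a : L, U = ~` variety X a].

Lemma zariski_openT : zariski_open setT.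
Proof.
have [c] := hL (finite_set0 L).
by rewrite bigcup_set0 => Vc; exists c; rewrite -Vc setC0.
Qed.

Lemma zariski_openI : setI_closed zariski_open.
Proof.
move=> _ _ [a ->] [b ->].
have [c] := hL (finite_set2 a b).
by rewrite bigcup_setU !bigcup_set1 => Vc; exists c; rewrite -Vc setCU.
Qed.

Lemma zariski_open_bigU (I : Type) (f : I -> set Z) :
  (forall i, zariski_open (f i)) -> zariski_open (\bigcup_i f i).
Proof.
move=> /choice[a fa].
have [s [ubs lubs]] := supremums_neq0 (range a).
exists s; apply/seteqP; split=> x.
  move=> [i _]; rewrite fa => nax sx; apply: nax.
  by apply: le_trans sx; apply: ubs; exists i.
move=> nsx; apply: contrapT => nx; apply: nsx; apply: lubs => _ [i _ <-].
by apply: contrapT => nax; apply: nx; exists i => //; rewrite fa.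
Qed.

HB.instance Definition _ :=
  isOpenTopological.Build Z zariski_openT zariski_openI zariski_open_bigU.

Lemma zariski_openE : open = zariski_open.
Proof. by []. Qed.

End ZariskiTopology.

(* The suprema below are over subsets of {0, 1, ..., +oo}, and the supremum of
   the empty set is 0. *)
Definition height (d : Order.disp_t) (T : porderType d) (x : T) : \bar int :=
  supremum 0%E
    [set n%:Z%:E | n in [set n : nat |
      exists s : seq T, size s = n /\ sorted <%O (rcons s x)]].

Definition krull_dim (d : Order.disp_t) (T : porderType d) : \bar int :=
  supremum 0%E (range (@height d T)).

Definition kerneled (T : topologicalType) (x : T) : Prop :=
  [set x] = \bigcap_(U in [set U : set T | open U /\ U x]) U.

Definition T_quarter (T : topologicalType) : Prop :=
  forall x : T, closed [set x] \/ kerneled x.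

Definition open_separated (T : topologicalType) (A B : set T) : Prop :=
  exists U : set T, [/\ open U, A `<=` U & B `&` U = set0].

Definition T_F (T : topologicalType) : Prop :=
  forall (x : T) (F : set T), finite_set F -> F `<=` [set~ x] ->
    open_separated [set x] F \/ open_separated F [set x].

(* Main.v *)
(* The closure of {x} is V(x), and the intersection of the open sets containing
   x is {y | y <= x}; hence x is closed iff it is maximal in X and kerneled iff
   it is minimal.  So both T_1/4 and dim X <= 1 say that X has no chain
   x < y < z.  Such a chain violates T_F, since {y} cannot be separated from
   {x, z} either way.  Conversely, a maximal x is separated from F by the
   complement of V(x), and a minimal x by the complement of the finite union of
   the V(f), which is some V(c) because L is an X-top lattice. *)
Require Import Defs.
From mathcomp Require Import all_boot all_order all_algebra.
From mathcomp Require Import all_classical constructive_ereal topology.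

Import Order.TTheory.
Local Open Scope classical_set_scope.

Definition no_chain3 {d : Order.disp_t} (T : porderType d) : Prop :=
  forall x y z : T, (x < y)%O -> (y < z)%O -> False.

Lemma ge0_int_ereal {u : \bar int} :
  (0 <= u)%E -> (exists n : nat, u = n%:Z%:E) \/ u = +oo%E.
Proof.
by case: u => [[n|n]||] // _; [left; exists n | right].
Qed.

(** A nonnegative member confines the upper bounds to the naturals and [+oo]. If no natural number
    is a bound, the supremum is [+oo]; otherwise well-ordering gives a least one. Existence matters
    because [supremum] has a default value. *)
Lemma supremums_int_neq0 (A : set (\bar int)) :
  A !=set0 -> A `<=` [set u | (0 <= u)%E] -> supremums A !=set0.
Proof.
move=> [x Ax] A0.
have ub0 u : ubound A u -> (0 <= u)%E.
  by move=> /(_ x Ax); apply: le_trans; exact: A0.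
have [[n ubn]|noub] := pselect (exists n : nat, ubound A n%:Z%:E); last first.
  exists +oo%E; split=> [u _|u ubu]; first exact: leey.
  have [[n un]|->//] := ge0_int_ereal (ub0 u ubu).
  by case: noub; exists n; rewrite -un.
have exP : exists n : nat, `[< ubound A n%:Z%:E >] by exists n; apply/asboolP.
case: (ex_minnP exP) => m /asboolP ubm minm.
exists m%:Z%:E; split=> // u ubu.
have [[k uk]|->] := ge0_int_ereal (ub0 u ubu); last exact: leey.
by rewrite uk lee_fin lez_nat; apply: minm; apply/asboolP; rewrite -uk.
Qed.

Lemma le_supremum_int (A : set (\bar int)) (u : \bar int) :
  A `<=` [set u | (0 <= u)%E] -> A u -> (u <= supremum 0%E A)%E.
Proof.
move=> A0 Au; have An0 : A !=set0 by exists u.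
rewrite /supremum; case: ifPn => [/eqP A_0|_]; first by rewrite A_0 in Au.
by case: xgetP => [s _ [ubs _]|/(_ _) ns]; [exact: ubs |
  have [s /ns] := supremums_int_neq0 A An0 A0].
Qed.

Lemma supremum_int_le (A : set (\bar int)) (u : \bar int) :
  (0 <= u)%E -> ubound A u -> (supremum 0%E A <= u)%E.
Proof.
(* The hypothesis [0 <= u] covers the cases where [supremum] takes its default value 0. *)
move=> u0 ubu; rewrite /supremum; case: ifPn => // _.
by case: xgetP => // s _ [_]; apply.
Qed.

Lemma height_ge0 {d : Order.disp_t} (T : porderType d) (x : T) :
  (0 <= height x)%E.
Proof.
apply: le_supremum_int => [_ [n _ <-]|]; first by rewrite /= lee_fin.
by exists 0%N => //; exists [::].
Qed.

Lemma krull_dim_le1P {d : Order.disp_t} (T : porderType d) :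
  (krull_dim T <= 1)%E <-> no_chain3 T.
Proof.
split=> [dim1 x y z xy yz|nch].
  have : (2%:Z%:E <= height z)%E.
    apply: le_supremum_int => [_ [n _ <-]|]; first by rewrite /= lee_fin.
    by exists 2%N => //; exists [:: x; y]; rewrite /= xy yz.
  move=> /le_trans h2.
  have /h2 : (height z <= krull_dim T)%E.
    by apply: le_supremum_int => [_ [t _ <-]|]; [exact: height_ge0 | exists z].
  by move=> /le_trans /(_ dim1).
apply: supremum_int_le => // _ [x _ <-].
apply: supremum_int_le => // _ [n [s [<- sx]] <-].
(* With two or more entries in [s], the first three entries of [rcons s x] form a forbidden chain;
   the third is [x] itself when [s] has exactly two. *)
case: s sx => [|a [|b [|c s]]] //=.
  by case/and3P=> ab bx _; case: (nch _ _ _ ab bx).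
by case/and3P=> ab bc _; case: (nch _ _ _ ab bc).
Qed.

Section ZariskiSeparation.
Context {d : Order.disp_t} {L : completeLatticeType d} {X : set L}.
Context (hL : xtop X).
Local Notation Z := (zariski hL).

(** Varieties are upward closed, so their complements are downward closed. *)
Lemma zariski_open_le {x y : Z} {U : set Z} :
  open U -> (x <= y)%O -> U y -> U x.
Proof.
rewrite zariski_openE => -[a ->] xy nay ax; apply: nay.
exact: le_trans ax xy.
Qed.

Lemma open_not_ge (x : Z) : open [set y : Z | ~ (x <= y)%O].
Proof. by rewrite zariski_openE; exists (val x). Qed.

Lemma closed_set1P (x : Z) :
  closed [set x] <-> forall y : Z, ~ (x < y)%O.
Proof.
split=> [|xmax]; rewrite -openC.
  move=> oC y xy.
  have : (~` [set x] : set Z) x.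
    by apply: (zariski_open_le oC (ltW xy)) => yx; rewrite yx ltxx in xy.
  exact.
suff -> : ~` [set x] = [set y : Z | ~ (x <= y)%O] by exact: open_not_ge.
apply/seteqP; split=> y /=.
  move=> yx; rewrite le_eqVlt => /orP[/eqP xy|/xmax//].
  by apply: yx; rewrite xy.
by move=> nxy yx; apply: nxy; rewrite yx.
Qed.

Lemma kerneledP (x : Z) : kerneled x <-> forall y : Z, ~ (y < x)%O.
Proof.
split=> [kx y yx|xmin].
  have : [set x] y.
    by rewrite kx => U [oU Ux]; exact: zariski_open_le oU (ltW yx) Ux.
  by move=> xy; rewrite xy ltxx in yx.
apply/seteqP; split=> [_ -> U [] //|y yU].
have yx : (y <= x)%O.
  (* Otherwise the complement of V(y) would be an open set containing [x] but not [y]. *)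
  apply: contrapT => nyx.
  by apply: (yU [set z : Z | ~ (y <= z)%O]) => //; split=> //; exact: open_not_ge.
by move: yx; rewrite le_eqVlt => /orP[/eqP|/xmin].
Qed.

Lemma T_quarterP : T_quarter Z <-> no_chain3 Z.
Proof.
split=> [T4 x y z xy yz|nch x].
  by case: (T4 y) => [/closed_set1P/(_ _ yz)|/kerneledP/(_ _ xy)].
have [|ncl] := pselect (closed [set x]); [by left | right].
(* A point that is not closed has some [z] above it, so a [y] below it would complete a chain. *)
apply/kerneledP => y yx; apply: ncl; apply/closed_set1P => z xz.
exact: nch yx xz.
Qed.

Lemma T_FP : T_F Z <-> no_chain3 Z.
Proof.
split=> [TF x y z xy yz|/T_quarterP T4 x F finF Fx].
  have sF : ([set x; z] : set Z) `<=` [set~ y].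
    by move=> _ [->|->] ty; rewrite ty ltxx in xy yz.
  (* By downward closure, an open set containing [y] contains [x], and one containing [z] contains
     [y]. *)
  case: (TF y [set x; z] (finite_set2 _ _) sF) => -[U [oU sU dU]].
    have : ([set x; z] `&` U) x.
      by split; [left | apply: (zariski_open_le oU (ltW xy)); exact: sU].
    by rewrite dU.
  have : ([set y] `&` U) y.
    by split=> //; apply: (zariski_open_le oU (ltW yz)); apply: sU; right.
  by rewrite dU.
case: (T4 x) => [clx|/kerneledP xmin].
  right; exists (~` [set x]); split=> //; first by rewrite openC.
  by rewrite setICr.
(* [xtop] concerns families in [L], hence the image of [F] under [val]. Minimality of [x] keeps it
   out of each V(f), as [x] differs from [f]. *)
left; have [c Vc] := hL _ (finite_image (val : Z -> L) finF).
exists (~` variety X c); split; first by rewrite zariski_openE; exists c.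
  move=> _ ->; rewrite -Vc => -[_ [f Ff <-]] fx.
  have : (f <= x)%O := fx.
  by rewrite le_eqVlt => /orP[/eqP /(Fx _ Ff)|/xmin].
apply/disjoints_subset => f Ff; rewrite setCK -Vc.
by exists (val f); [exists f | exact: lexx].
Qed.

End ZariskiSeparation.

Theorem theorem3p4 (d : Order.disp_t) (L : completeLatticeType d) (X : set L)
    (hX : X `<=` [set~ \top%O]) (hL : xtop X) :
  [<-> T_quarter (zariski hL);
       (krull_dim (zariski hL) <= 1)%E;
       T_F (zariski hL)].
Proof.
tfae.
- by move=> /T_quarterP/krull_dim_le1P.
- by move=> /krull_dim_le1P/T_FP.
- by move=> /T_FP/T_quarterP.
Qed.
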